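(* Let $X$ be an everywhere strictly local scheme and let $Y$ be an irreducible scheme. Then every integral morphism $f:Y\to X$ is radical, in particular an injective map.
   Context: A scheme $X$ is everywhere strictly local if for every $x\in X$ the local ring $\mathcal{O}_{X,x}$ is strictly local, i.e. henselian with separably closed residue field. A morphism $f:Y\to X$ is radical if it is universally injective; equivalently, it is injective and for each $y\in Y$ with $x=f(y)$ the residue field extension $\kappa(x)\subset\kappa(y)$ is purely inseparable. *)

(* Defs.v *)
From HB Require Import structures.
From mathcomp Require Import all_boot all_order all_algebra all_field.
From mathcomp Require Import ring.
From mathcomp Require Import mathcomp_extra boolp classical_sets topology.

Set Implicit Arguments.
Unset Strict Implicit.
Unset Printing Implicit Defensive.

Import GRing.Theory.
Local Open Scope classical_set_scope.
Local Open Scope quotient_scope.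
Local Open Scope ring_scope.

(** Lets [U x] be written for [U] in a type that coerces to [set]. *)
Identity Coercion set_to_fun : set >-> Funclass.

(** Rings are commutative and unital, possibly zero ([comPzRingType]), since
    the ring of sections over the empty open set is zero. *)

Definition invertible (R : comPzRingType) (a : R) : Prop :=
  exists b : R, a * b = 1.

Definition is_local (R : comPzRingType) : Prop :=
  (1 : R) <> 0 /\
  forall a b : R, ~ invertible a -> ~ invertible b -> ~ invertible (a + b).

(** A nonzero ring, so that polynomials over it make sense in the library. *)
Record localRing := LocalRing {
  localRing_sort :> comNzRingType;
  localRingP : is_local localRing_sort }.

Section ResidueField.
Variable R : localRing.

Definition max_ideal (a : R) : bool := `[< ~ invertible a >].

Lemma max_idealP (a : R) : reflect (~ invertible a) (max_ideal a).
Proof. exact: asboolP. Qed.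

Lemma max_ideal_closed : idealr_closed max_ideal.
Proof.
have mulP (a b : R) : ~ invertible b -> ~ invertible (a * b).
  by move=> nb [c abc]; apply: nb; exists (a * c); rewrite mulrCA mulrA.
split.
- apply/max_idealP => -[b]; rewrite mul0r => /esym.
  by case: (localRingP R).
- by apply/negP => /max_idealP; apply; exists 1; rewrite mulr1.
- move=> a u v /max_idealP nu /max_idealP nv; apply/max_idealP.
  by have [_] := localRingP R; apply => //; exact: mulP.
Qed.

HB.instance Definition _ := isIdealr.Build R max_ideal max_ideal_closed.

Definition residue_field := {ideal_quot [the idealr R of max_ideal]}.
HB.instance Definition _ := GRing.ComNzRing.on residue_field.

Definition residue (a : R) : residue_field := \pi_residue_field a.

Lemma residue_eq (a b : R) :
  residue a = residue b <-> ~ invertible (a - b).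
Proof.
split; first by move/eqP; rewrite -Quotient.idealrBE => /max_idealP.
by move=> ab; apply/eqP; rewrite -Quotient.idealrBE; apply/max_idealP.
Qed.

Lemma residue_is_zmod_morphism : zmod_morphism residue.
Proof. by move=> a b; rewrite /residue rmorphB. Qed.

Lemma residue_is_monoid_morphism : monoid_morphism residue.
Proof. by split=> [|a b]; rewrite /residue ?rmorph1 ?rmorphM. Qed.

HB.instance Definition _ :=
  GRing.isZmodMorphism.Build R residue_field residue residue_is_zmod_morphism.
HB.instance Definition _ :=
  GRing.isMonoidMorphism.Build R residue_field residue
    residue_is_monoid_morphism.

Lemma residue_surj (k : residue_field) : exists a, k = residue a.
Proof. by exists (repr k); rewrite /residue reprK. Qed.

Lemma residue_field_inv_ex (k : residue_field) :
  exists l : residue_field, (k != 0 -> l * k = 1) /\ (k = 0 -> l = 0).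
Proof.
have [->|k0] := eqVneq k 0; first by exists 0.
have [a ka] := residue_surj k.
have [[b ab]|na] := pselect (invertible a).
  exists (residue b); split=> [_|k0']; last by rewrite k0' eqxx in k0.
  by rewrite ka -rmorphM mulrC ab rmorph1.
case/eqP: k0; rewrite ka -(rmorph0 residue).
by apply/residue_eq; rewrite subr0.
Qed.

Definition residue_field_inv (k : residue_field) : residue_field :=
  sval (cid (residue_field_inv_ex k)).

Lemma residue_field_mulVf (k : residue_field) :
  k != 0 -> residue_field_inv k * k = 1.
Proof. exact: (svalP (cid (residue_field_inv_ex k))).1. Qed.

Lemma residue_field_inv0 : residue_field_inv 0 = 0.
Proof. exact: (svalP (cid (residue_field_inv_ex 0))).2. Qed.

HB.instance Definition _ := GRing.ComNzRing_isField.Build residue_field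
  residue_field_mulVf residue_field_inv0.

End ResidueField.

Definition henselian (R : localRing) : Prop :=
  forall (f : {poly R}) (g0 h0 : {poly residue_field R}),
    f \is monic -> g0 \is monic -> h0 \is monic -> coprimep g0 h0 ->
    map_poly (@residue R) f = g0 * h0 ->
    exists g h : {poly R},
      [/\ g \is monic, h \is monic, f = g * h,
          map_poly (@residue R) g = g0 & map_poly (@residue R) h = h0].

Definition separably_closed (k : fieldType) : Prop :=
  forall p : {poly k}, separable_poly p -> (1 < size p)%N ->
    exists x : k, root p x.

Definition strictly_local (R : localRing) : Prop :=
  henselian R /\ separably_closed (residue_field R).

(** [[pchar L].-nat n] says that [n] is a power of the characteristic exponent
    of [L] (see [purely_inseparable_elementP_pchar], the library's notion being
    restricted to finite extensions). *)
Definition purely_inseparable_hom (K L : fieldType) (f : K -> L) : Prop :=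
  forall x : L, exists2 n : nat, [pchar L].-nat n & exists a : K, f a = x ^+ n.

(** [n = 0] is allowed: it forces [B] to be zero. *)
Definition integral_hom (A B : comPzRingType) (f : A -> B) : Prop :=
  forall b : B, exists (n : nat) (c : 'I_n -> A),
    b ^+ n + \sum_(i < n) f (c i) * b ^+ i = 0.

Record opens (T : topologicalType) := Opens {
  opens_set :> set T;
  opensP : open opens_set }.

Definition opensT (T : topologicalType) : opens T := Opens openT.

Definition opensI (T : topologicalType) (U V : opens T) : opens T :=
  Opens (openI (opensP U) (opensP V)).

Lemma opensIl (T : topologicalType) (U V : opens T) : opensI U V `<=` U.
Proof. exact: subIsetl. Qed.

Lemma opensIr (T : topologicalType) (U V : opens T) : opensI U V `<=` V.
Proof. exact: subIsetr. Qed.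

Definition opens_preimage (S T : topologicalType) (f : S -> T)
    (cf : continuous f) (U : opens T) : opens S :=
  Opens ((continuousP f).1 cf U (opensP U)).

(** The last field is the sheaf condition; uniqueness of the glued section is
    part of it. *)
Record ringedSpace := RingedSpace {
  rs_space :> topologicalType;
  sect : opens rs_space -> comPzRingType;
  res : forall U V : opens rs_space,
    V `<=` U -> {rmorphism sect U -> sect V};
  res_id : forall (U : opens rs_space) (UU : U `<=` U) (s : sect U),
    res UU s = s;
  res_comp : forall (U V W : opens rs_space)
    (VU : V `<=` U) (WV : W `<=` V) (WU : W `<=` U) (s : sect U),
    res WV (res VU s) = res WU s;
  sect_glue : forall (I : Type) (U : opens rs_space) (V : I -> opens rs_space)
    (VU : forall i, V i `<=` U) (s : forall i, sect (V i)),
    U `<=` \bigcup_i V i ->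
    (forall i j,
       res (@opensIl _ (V i) (V j)) (s i) = res (@opensIr _ (V i) (V j)) (s j)) ->
    exists! t : sect U, forall i, res (VU i) t = s i }.

Arguments sect : clear implicits.
Arguments res {r U V} _.

Section Stalk.
Variables (X : ringedSpace) (x : X).

Record preGerm := PreGerm {
  pg_dom : opens X;
  pg_in : pg_dom x;
  pg_sect : sect X pg_dom }.

HB.instance Definition _ := gen_eqMixin preGerm.
HB.instance Definition _ := gen_choiceMixin preGerm.

Definition same_germ (a b : preGerm) : bool :=
  `[< exists (W : opens X) (Wa : W `<=` pg_dom a) (Wb : W `<=` pg_dom b),
        W x /\ res Wa (pg_sect a) = res Wb (pg_sect b) >].

Lemma same_germ_equiv : equiv_class_of same_germ.
Proof.
have sym a b : same_germ a b -> same_germ b a.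
  by move=> /asboolP[W [Wa [Wb [Wx e]]]]; apply/asboolP; exists W, Wb, Wa.
split=> [a|a b|b a c].
- by apply/asboolP; exists (pg_dom a), (@subset_refl _ _), (@subset_refl _ _); split=> //; exact: pg_in.
- by apply/idP/idP; exact: sym.
- move=> /asboolP[W [Wa [Wb [Wx e]]]] /asboolP[V [Vb [Vc [Vx e']]]].
  apply/asboolP; exists (opensI W V).
  exists (subset_trans (@opensIl _ W V) Wa).
  exists (subset_trans (@opensIr _ W V) Vc); split=> //.
  rewrite -(res_comp Wa (@opensIl _ W V)) e.
  rewrite -(res_comp Vc (@opensIr _ W V)) -e'.
  rewrite (res_comp _ _ (subset_trans (@opensIl _ W V) Wb)).
  by rewrite (res_comp _ _ (subset_trans (@opensIl _ W V) Wb)).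
Qed.

Canonical same_germ_equivRel := EquivRelPack same_germ_equiv.

Definition stalk := {eq_quot same_germ}.
HB.instance Definition _ := Choice.on stalk.

Definition germ (U : opens X) (Ux : U x) (s : sect X U) : stalk :=
  \pi_stalk (PreGerm Ux s).

Lemma germ_eq (U V : opens X) (Ux : U x) (Vx : V x)
    (s : sect X U) (t : sect X V) :
  germ Ux s = germ Vx t <->
  exists (W : opens X) (WU : W `<=` U) (WV : W `<=` V),
    W x /\ res WU s = res WV t.
Proof.
by split=> [/eqmodP/asboolP//|e]; apply/eqmodP/asboolP.
Qed.

Lemma germ_res (U V : opens X) (VU : V `<=` U) (Ux : U x) (Vx : V x)
    (s : sect X U) : germ Vx (res VU s) = germ Ux s.
Proof.
by apply/germ_eq; exists V, (@subset_refl _ _), VU; split=> //; rewrite res_id.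
Qed.

Lemma germ_surj (a : stalk) :
  exists (U : opens X) (Ux : U x) (s : sect X U), a = germ Ux s.
Proof.
exists (pg_dom (repr a)), (pg_in (repr a)), (pg_sect (repr a)).
by rewrite -[LHS]reprK /germ; case: (repr a).
Qed.

Lemma germ_surj2 (a b : stalk) :
  exists (U : opens X) (Ux : U x) (s t : sect X U),
    a = germ Ux s /\ b = germ Ux t.
Proof.
have [U [Ux [s ->]]] := germ_surj a; have [V [Vx [t ->]]] := germ_surj b.
exists (opensI U V), (conj Ux Vx), (res (@opensIl _ U V) s).
by exists (res (@opensIr _ U V) t); rewrite !germ_res.
Qed.

Lemma germ_surj3 (a b c : stalk) :
  exists (U : opens X) (Ux : U x) (s t r : sect X U),
    [/\ a = germ Ux s, b = germ Ux t & c = germ Ux r].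
Proof.
have [U [Ux [s [t [-> ->]]]]] := germ_surj2 a b.
have [V [Vx [r ->]]] := germ_surj c.
exists (opensI U V), (conj Ux Vx), (res (@opensIl _ U V) s).
exists (res (@opensIl _ U V) t), (res (@opensIr _ U V) r).
by rewrite !germ_res.
Qed.

Definition stalk_lift2 (op : forall U : opens X, sect X U -> sect X U -> sect X U)
    (a b : stalk) : stalk :=
  let U := pg_dom (repr a) in let V := pg_dom (repr b) in
  @germ (opensI U V) (conj (pg_in (repr a)) (pg_in (repr b)))
    (op _ (res (@opensIl _ U V) (pg_sect (repr a)))
          (res (@opensIr _ U V) (pg_sect (repr b)))).

Lemma stalk_lift2E op (U : opens X) (Ux : U x) (s t : sect X U) :
  (forall (U V : opens X) (VU : V `<=` U) (s t : sect X U),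
     res VU (op U s t) = op V (res VU s) (res VU t)) ->
  stalk_lift2 op (germ Ux s) (germ Ux t) = germ Ux (op U s t).
Proof.
move=> op_res; rewrite /stalk_lift2.
have : germ Ux s = \pi_stalk (repr (germ Ux s)) by rewrite reprK.
have : germ Ux t = \pi_stalk (repr (germ Ux t)) by rewrite reprK.
case: (repr (germ Ux s)) => S Sx s'; case: (repr (germ Ux t)) => T Tx t' /=.
move=> /germ_eq[W [WU [WT [Wx et]]]] /germ_eq[V [VU [VS [Vx es]]]].
apply/germ_eq; exists (opensI W V).
have WVST : opensI W V `<=` opensI S T by move=> z [Wz Vz]; split; auto.
have WVU : opensI W V `<=` U by move=> z [Wz _]; exact (WU z Wz).
exists WVST, WVU; split=> //; rewrite !op_res; congr op.
- rewrite (res_comp _ _ (subset_trans (@opensIr _ W V) VS)).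
  rewrite -(res_comp VS (@opensIr _ W V)) -es.
  exact: res_comp.
- rewrite (res_comp _ _ (subset_trans (@opensIl _ W V) WT)).
  rewrite -(res_comp WT (@opensIl _ W V)) -et.
  exact: res_comp.
Qed.

Definition stalk_add := stalk_lift2 (fun U s t => s + t).
Definition stalk_mul := stalk_lift2 (fun U s t => s * t).
Definition stalk_zero : stalk := @germ (opensT X) I 0.
Definition stalk_one : stalk := @germ (opensT X) I 1.
Definition stalk_opp (a : stalk) : stalk :=
  germ (pg_in (repr a)) (- pg_sect (repr a)).

Lemma stalk_addE (U : opens X) (Ux : U x) (s t : sect X U) :
  stalk_add (germ Ux s) (germ Ux t) = germ Ux (s + t).
Proof. by rewrite /stalk_add stalk_lift2E // => *; rewrite rmorphD. Qed.

Lemma stalk_mulE (U : opens X) (Ux : U x) (s t : sect X U) :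
  stalk_mul (germ Ux s) (germ Ux t) = germ Ux (s * t).
Proof. by rewrite /stalk_mul stalk_lift2E // => *; rewrite rmorphM. Qed.

Lemma stalk_zeroE (U : opens X) (Ux : U x) : stalk_zero = germ Ux 0.
Proof.
by rewrite /stalk_zero -(@germ_res (opensT X) U (@subsetT _ U) I Ux) rmorph0.
Qed.

Lemma stalk_oneE (U : opens X) (Ux : U x) : stalk_one = germ Ux 1.
Proof.
by rewrite /stalk_one -(@germ_res (opensT X) U (@subsetT _ U) I Ux) rmorph1.
Qed.

Lemma stalk_oppE (U : opens X) (Ux : U x) (s : sect X U) :
  stalk_opp (germ Ux s) = germ Ux (- s).
Proof.
rewrite /stalk_opp.
have : germ Ux s = \pi_stalk (repr (germ Ux s)) by rewrite reprK.
case: (repr (germ Ux s)) => S Sx s' /= /germ_eq[W [WU [WS [Wx es]]]].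
by apply/germ_eq; exists W, WS, WU; split=> //; rewrite !rmorphN es.
Qed.

Lemma stalk_addA : associative stalk_add.
Proof.
move=> a b c; have [U [Ux [s [t [r [-> -> ->]]]]]] := germ_surj3 a b c.
by rewrite !stalk_addE addrA.
Qed.

Lemma stalk_addC : commutative stalk_add.
Proof.
move=> a b; have [U [Ux [s [t [-> ->]]]]] := germ_surj2 a b.
by rewrite !stalk_addE addrC.
Qed.

Lemma stalk_add0 : left_id stalk_zero stalk_add.
Proof.
move=> a; have [U [Ux [s ->]]] := germ_surj a.
by rewrite (stalk_zeroE Ux) stalk_addE add0r.
Qed.

Lemma stalk_addN : left_inverse stalk_zero stalk_opp stalk_add.
Proof.
move=> a; have [U [Ux [s ->]]] := germ_surj a.
by rewrite stalk_oppE stalk_addE addNr -stalk_zeroE.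
Qed.

HB.instance Definition _ :=
  GRing.isZmodule.Build stalk stalk_addA stalk_addC stalk_add0 stalk_addN.

Lemma stalk_mulA : associative stalk_mul.
Proof.
move=> a b c; have [U [Ux [s [t [r [-> -> ->]]]]]] := germ_surj3 a b c.
by rewrite !stalk_mulE mulrA.
Qed.

Lemma stalk_mulC : commutative stalk_mul.
Proof.
move=> a b; have [U [Ux [s [t [-> ->]]]]] := germ_surj2 a b.
by rewrite !stalk_mulE mulrC.
Qed.

Lemma stalk_mul1 : left_id stalk_one stalk_mul.
Proof.
move=> a; have [U [Ux [s ->]]] := germ_surj a.
by rewrite (stalk_oneE Ux) stalk_mulE mul1r.
Qed.

Lemma stalk_mulDl : left_distributive stalk_mul +%R.
Proof.
move=> a b c; have [U [Ux [s [t [r [-> -> ->]]]]]] := germ_surj3 a b c.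
by rewrite /GRing.add /= !(stalk_mulE, stalk_addE) mulrDl.
Qed.

HB.instance Definition _ := GRing.Zmodule_isComPzRing.Build stalk
  stalk_mulA stalk_mulC stalk_mul1 stalk_mulDl.

Lemma germ_is_zmod_morphism (U : opens X) (Ux : U x) :
  zmod_morphism (germ Ux).
Proof.
move=> s t; have -> : - germ Ux t = germ Ux (- t) by exact: stalk_oppE.
by symmetry; exact: stalk_addE.
Qed.

Lemma germ_is_monoid_morphism (U : opens X) (Ux : U x) :
  monoid_morphism (germ Ux).
Proof.
by split=> [|s t]; symmetry; [exact: stalk_oneE|exact: stalk_mulE].
Qed.

HB.instance Definition _ (U : opens X) (Ux : U x) :=
  GRing.isZmodMorphism.Build (sect X U) stalk (germ Ux)
    (@germ_is_zmod_morphism U Ux).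
HB.instance Definition _ (U : opens X) (Ux : U x) :=
  GRing.isMonoidMorphism.Build (sect X U) stalk (germ Ux)
    (@germ_is_monoid_morphism U Ux).

End Stalk.

Record rsHom (Y X : ringedSpace) := RsHom {
  rs_map :> Y -> X;
  rs_cont : continuous rs_map;
  pull : forall U : opens X,
    {rmorphism sect X U -> sect Y (opens_preimage rs_cont U)};
  pull_res : forall (U V : opens X) (VU : V `<=` U)
    (fVU : opens_preimage rs_cont V `<=` opens_preimage rs_cont U)
    (s : sect X U), pull V (res VU s) = res fVU (pull U s) }.

Arguments rs_cont {Y X} f : rename.
Arguments pull {Y X} f U : rename.

Definition preimage_opens (Y X : ringedSpace) (f : rsHom Y X) :
    opens X -> opens Y :=
  opens_preimage (rs_cont f).

Section StalkMap.
Variables (Y X : ringedSpace) (f : rsHom Y X) (y : Y).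

Definition stalk_map (a : stalk (f y)) : stalk y :=
  @germ Y y (preimage_opens f (pg_dom (repr a))) (pg_in (repr a))
    (pull f _ (pg_sect (repr a))).

Lemma stalk_map_germ (U : opens X) (Ux : U (f y)) (s : sect X U) :
  stalk_map (germ Ux s) =
  @germ Y y (preimage_opens f U) Ux (pull f U s).
Proof.
rewrite /stalk_map.
have : germ Ux s = \pi_(stalk (f y)) (repr (germ Ux s)) by rewrite reprK.
case: (repr (germ Ux s)) => S Sx s' /= /germ_eq[W [WU [WS [Wx es]]]].
have fWS : preimage_opens f W `<=` preimage_opens f S.
  by move=> z; exact (WS (f z)).
have fWU : preimage_opens f W `<=` preimage_opens f U.
  by move=> z; exact (WU (f z)).
by apply/germ_eq; exists (preimage_opens f W), fWS, fWU; split=> //;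
  rewrite -!pull_res es.
Qed.

Lemma stalk_map_is_zmod_morphism : zmod_morphism stalk_map.
Proof.
move=> a b; have [U [Ux [s [t [-> ->]]]]] := germ_surj2 a b.
by rewrite -rmorphB !stalk_map_germ !rmorphB.
Qed.

Lemma stalk_map_is_monoid_morphism : monoid_morphism stalk_map.
Proof.
split=> [|a b].
  by rewrite [X in stalk_map X](@stalk_oneE X _ (opensT X) I)
             stalk_map_germ !rmorph1.
have [U [Ux [s [t [-> ->]]]]] := germ_surj2 a b.
by rewrite -rmorphM !stalk_map_germ !rmorphM.
Qed.

HB.instance Definition _ := GRing.isZmodMorphism.Build
  (stalk (f y)) (stalk y) stalk_map stalk_map_is_zmod_morphism.
HB.instance Definition _ := GRing.isMonoidMorphism.Build
  (stalk (f y)) (stalk y) stalk_map stalk_map_is_monoid_morphism.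

End StalkMap.

Arguments stalk_map {Y X} f {y} a.

Record spec (A : comPzRingType) := Spec {
  spec_ideal :> set A;
  spec0 : spec_ideal 0;
  specD : forall a b, spec_ideal a -> spec_ideal b -> spec_ideal (a + b);
  specM : forall a b, spec_ideal b -> spec_ideal (a * b);
  spec1 : ~ spec_ideal 1;
  spec_prime : forall a b,
    spec_ideal (a * b) -> spec_ideal a \/ spec_ideal b }.

(** Localization of a ring at a prime ideal: fractions [a / s] with [s] outside
    [p], and [a / s = b / t] when [u (a t - b s) = 0] for some [u] outside
    [p]. *)
Section Localization.
Variables (A : comPzRingType) (p : spec A).

Record preFrac := PreFrac {
  pf_num : A;
  pf_den : A;
  pf_den_notin : ~ p pf_den }.

HB.instance Definition _ := gen_eqMixin preFrac.
HB.instance Definition _ := gen_choiceMixin preFrac.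

Definition same_frac (a b : preFrac) : bool :=
  `[< exists2 u, ~ p u &
        u * (pf_num a * pf_den b - pf_num b * pf_den a) = 0 >].

Lemma notin_mul (s t : A) : ~ p s -> ~ p t -> ~ p (s * t).
Proof. by move=> ps pt /spec_prime[]. Qed.

Lemma same_frac_equiv : equiv_class_of same_frac.
Proof.
have sym a b : same_frac a b -> same_frac b a.
  move=> /asboolP[u pu e]; apply/asboolP; exists u => //.
  by rewrite -opprB mulrN e oppr0.
split=> [a|a b|b a c].
- by apply/asboolP; exists 1; rewrite ?subrr ?mulr0 //; exact: spec1.
- by apply/idP/idP; exact: sym.
- move=> /asboolP[u pu e] /asboolP[v pv e']; apply/asboolP.
  exists (u * v * pf_den b).
    by apply: notin_mul; [exact: notin_mul|exact: pf_den_notin].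
  transitivity
    (v * pf_den c * (u * (pf_num a * pf_den b - pf_num b * pf_den a)) +
     u * pf_den a * (v * (pf_num b * pf_den c - pf_num c * pf_den b))).
    by ring.
  by rewrite e e' !mulr0 addr0.
Qed.

Canonical same_frac_equivRel := EquivRelPack same_frac_equiv.

Definition localization := {eq_quot same_frac}.
HB.instance Definition _ := Choice.on localization.

Definition frac (a s : A) (ps : ~ p s) : localization :=
  \pi_localization (PreFrac a ps).

Lemma frac_eq (a s b t : A) (ps : ~ p s) (pt : ~ p t) :
  frac a ps = frac b pt <-> exists2 u, ~ p u & u * (a * t - b * s) = 0.
Proof.
by split=> [/eqmodP/asboolP//|e]; apply/eqmodP/asboolP.
Qed.

Lemma frac_surj (x : localization) :
  exists (a s : A) (ps : ~ p s), x = frac a ps.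
Proof.
exists (pf_num (repr x)), (pf_den (repr x)), (@pf_den_notin (repr x)).
by rewrite -[LHS]reprK /frac; case: (repr x).
Qed.

Definition frac_add (x y : localization) : localization :=
  frac (pf_num (repr x) * pf_den (repr y) + pf_num (repr y) * pf_den (repr x))
    (notin_mul (@pf_den_notin (repr x)) (@pf_den_notin (repr y))).

Definition frac_mul (x y : localization) : localization :=
  frac (pf_num (repr x) * pf_num (repr y))
    (notin_mul (@pf_den_notin (repr x)) (@pf_den_notin (repr y))).

Definition frac_opp (x : localization) : localization :=
  frac (- pf_num (repr x)) (@pf_den_notin (repr x)).

Definition frac_zero : localization := frac 0 (@spec1 _ p).
Definition frac_one : localization := frac 1 (@spec1 _ p).

Lemma frac_addE (a s b t : A) (ps : ~ p s) (pt : ~ p t) :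
  frac_add (frac a ps) (frac b pt) = frac (a * t + b * s) (notin_mul ps pt).
Proof.
rewrite /frac_add.
have : frac a ps = \pi_localization (repr (frac a ps)) by rewrite reprK.
have : frac b pt = \pi_localization (repr (frac b pt)) by rewrite reprK.
case: (repr (frac a ps)) => a' s' ps'; case: (repr (frac b pt)) => b' t' pt' /=.
move=> /frac_eq[v pv eb] /frac_eq[u pu ea].
apply/frac_eq; exists (u * v); first exact: notin_mul.
transitivity (- (v * t * t' * (u * (a * s' - a' * s)) +
                 u * s * s' * (v * (b * t' - b' * t)))); first by ring.
by rewrite ea eb !mulr0 addr0 oppr0.
Qed.

Lemma frac_mulE (a s b t : A) (ps : ~ p s) (pt : ~ p t) :
  frac_mul (frac a ps) (frac b pt) = frac (a * b) (notin_mul ps pt).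
Proof.
rewrite /frac_mul.
have : frac a ps = \pi_localization (repr (frac a ps)) by rewrite reprK.
have : frac b pt = \pi_localization (repr (frac b pt)) by rewrite reprK.
case: (repr (frac a ps)) => a' s' ps'; case: (repr (frac b pt)) => b' t' pt' /=.
move=> /frac_eq[v pv eb] /frac_eq[u pu ea].
apply/frac_eq; exists (u * v); first exact: notin_mul.
transitivity (- (v * b * t' * (u * (a * s' - a' * s)) +
                 u * a' * s * (v * (b * t' - b' * t)))); first by ring.
by rewrite ea eb !mulr0 addr0 oppr0.
Qed.

Lemma frac_oppE (a s : A) (ps : ~ p s) :
  frac_opp (frac a ps) = frac (- a) ps.
Proof.
rewrite /frac_opp.
have : frac a ps = \pi_localization (repr (frac a ps)) by rewrite reprK.
case: (repr (frac a ps)) => a' s' ps' /= /frac_eq[u pu ea].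
apply/frac_eq; exists u => //.
by transitivity (u * (a * s' - a' * s)); [ring|].
Qed.

Lemma frac_cross (a s b t : A) (ps : ~ p s) (pt : ~ p t) :
  a * t = b * s -> frac a ps = frac b pt.
Proof.
move=> e; apply/frac_eq; exists 1; first exact: spec1.
by rewrite e subrr mulr0.
Qed.

Lemma frac_addA : associative frac_add.
Proof.
move=> x y z; have [a [s [ps ->]]] := frac_surj x.
have [b [t [pt ->]]] := frac_surj y; have [c [r [pr ->]]] := frac_surj z.
by rewrite !frac_addE; apply: frac_cross; ring.
Qed.

Lemma frac_addC : commutative frac_add.
Proof.
move=> x y; have [a [s [ps ->]]] := frac_surj x.
have [b [t [pt ->]]] := frac_surj y.
by rewrite !frac_addE; apply: frac_cross; ring.
Qed.

Lemma frac_add0 : left_id frac_zero frac_add.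
Proof.
move=> x; have [a [s [ps ->]]] := frac_surj x.
by rewrite frac_addE; apply: frac_cross; ring.
Qed.

Lemma frac_addN : left_inverse frac_zero frac_opp frac_add.
Proof.
move=> x; have [a [s [ps ->]]] := frac_surj x.
by rewrite frac_oppE frac_addE; apply: frac_cross; ring.
Qed.

HB.instance Definition _ := GRing.isZmodule.Build localization
  frac_addA frac_addC frac_add0 frac_addN.

Lemma frac_mulA : associative frac_mul.
Proof.
move=> x y z; have [a [s [ps ->]]] := frac_surj x.
have [b [t [pt ->]]] := frac_surj y; have [c [r [pr ->]]] := frac_surj z.
by rewrite !frac_mulE; apply: frac_cross; ring.
Qed.

Lemma frac_mulC : commutative frac_mul.
Proof.
move=> x y; have [a [s [ps ->]]] := frac_surj x.
have [b [t [pt ->]]] := frac_surj y.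
by rewrite !frac_mulE; apply: frac_cross; ring.
Qed.

Lemma frac_mul1 : left_id frac_one frac_mul.
Proof.
move=> x; have [a [s [ps ->]]] := frac_surj x.
by rewrite frac_mulE; apply: frac_cross; ring.
Qed.

Lemma frac_mulDl : left_distributive frac_mul +%R.
Proof.
move=> x y z; have [a [s [ps ->]]] := frac_surj x.
have [b [t [pt ->]]] := frac_surj y; have [c [r [pr ->]]] := frac_surj z.
by rewrite /GRing.add /= !(frac_mulE, frac_addE); apply: frac_cross; ring.
Qed.

HB.instance Definition _ := GRing.Zmodule_isComPzRing.Build localization
  frac_mulA frac_mulC frac_mul1 frac_mulDl.

Lemma addr_frac (a s b t : A) (ps : ~ p s) (pt : ~ p t) :
  frac a ps + frac b pt = frac (a * t + b * s) (notin_mul ps pt).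
Proof. exact: frac_addE. Qed.

Lemma mulr_frac (a s b t : A) (ps : ~ p s) (pt : ~ p t) :
  frac a ps * frac b pt = frac (a * b) (notin_mul ps pt).
Proof. exact: frac_mulE. Qed.

Lemma oppr_frac (a s : A) (ps : ~ p s) : - frac a ps = frac (- a) ps.
Proof. exact: frac_oppE. Qed.

End Localization.

Section Spec.
Variable A : comPzRingType.

HB.instance Definition _ := gen_eqMixin (spec A).
HB.instance Definition _ := gen_choiceMixin (spec A).

Definition zariski_open : set_system (spec A) :=
  [set U | exists E : set A, U = [set p : spec A | exists2 a, E a & ~ p a]].

Lemma zariski_openT : zariski_open setT.
Proof.
exists setT; apply/seteqP; split=> // p _.
by exists 1 => //; exact: spec1.
Qed.

Lemma zariski_openI : setI_closed zariski_open.
Proof.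
move=> _ _ [E ->] [F ->].
exists [set c | exists a b, [/\ E a, F b & c = a * b]].
apply/seteqP; split=> [p [[a Ea pa] [b Fb pb]]|p [_ [a [b [Ea Fb ->]]] pab]].
  by exists (a * b); [exists a, b|exact: notin_mul].
split; [exists a|exists b] => // pab'; apply: pab; last exact: specM.
by rewrite mulrC; exact: specM.
Qed.

Lemma zariski_open_bigU (I : Type) (f : I -> set (spec A)) :
  (forall i, zariski_open (f i)) -> zariski_open (\bigcup_i f i).
Proof.
move=> /choice[E fE]; exists (\bigcup_i E i).
apply/seteqP; split=> [p [i _]|p [a [i _ Ea] pa]].
  by rewrite fE => -[a Ea pa]; exists a => //; exists i.
by exists i => //; rewrite fE; exists a.
Qed.

HB.instance Definition _ := isOpenTopological.Build (spec A)
  zariski_openT zariski_openI zariski_open_bigU.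

(** Sections of the structure sheaf: families of elements of the local rings
    [A_p] that are locally given by a fraction. *)
Definition locally_frac (U : opens (spec A))
    (s : forall p : spec A, U p -> localization p) : Prop :=
  forall p : spec A, U p ->
    exists (V : opens (spec A)) (a b : A),
      [/\ V p, V `<=` U &
          forall q : spec A, V q -> exists qb : ~ q b,
            forall Uq : U q, s q Uq = frac a qb].

Record specSect (U : opens (spec A)) := SpecSect {
  ss_fun :> forall p : spec A, U p -> localization p;
  ss_frac : locally_frac ss_fun }.

HB.instance Definition _ U := gen_eqMixin (specSect U).
HB.instance Definition _ U := gen_choiceMixin (specSect U).

Lemma specSectP (U : opens (spec A)) (s t : specSect U) :
  (forall p (Up : U p), s p Up = t p Up) -> s = t.
Proof.
case: s t => [s sP] [t tP] /= e.
have est : s = t by apply: functional_extensionality_dep => p;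
  apply: functional_extensionality_dep => Up.
by subst t; congr SpecSect; exact: Prop_irrelevance.
Qed.

Section SpecSectRing.
Variable U : opens (spec A).
Implicit Types s t r : specSect U.

Lemma ss_const_frac (a : A) :
  locally_frac (fun (p : spec A) (_ : U p) => frac a (@spec1 _ p)).
Proof.
by move=> p Up; exists U, a, 1; split=> // q _; exists (@spec1 _ q).
Qed.

Definition ss_zero : specSect U := SpecSect (ss_const_frac 0).
Definition ss_one : specSect U := SpecSect (ss_const_frac 1).

Lemma ss_opp_frac s : locally_frac (fun p (Up : U p) => - s p Up).
Proof.
move=> p /(ss_frac s)[V [a [b [Vp VU e]]]].
exists V, (- a), b; split=> // q /e[qb {}e]; exists qb => Uq.
by rewrite e oppr_frac.
Qed.

Definition ss_opp s : specSect U := SpecSect (ss_opp_frac s).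

Lemma ss_add_frac s t : locally_frac (fun p (Up : U p) => s p Up + t p Up).
Proof.
move=> p Up; have [V [a [b [Vp VU e]]]] := ss_frac s Up.
have [W [c [d [Wp WU e']]]] := ss_frac t Up.
exists (opensI V W), (a * d + c * b), (b * d); split=> //.
  by move=> q [Vq _]; exact (VU q Vq).
move=> q [/e[qb {}e] /e'[qd {}e']]; exists (notin_mul qb qd) => Uq.
by rewrite e e' addr_frac.
Qed.

Definition ss_add s t : specSect U := SpecSect (@ss_add_frac s t).

Lemma ss_mul_frac s t : locally_frac (fun p (Up : U p) => s p Up * t p Up).
Proof.
move=> p Up; have [V [a [b [Vp VU e]]]] := ss_frac s Up.
have [W [c [d [Wp WU e']]]] := ss_frac t Up.
exists (opensI V W), (a * c), (b * d); split=> //.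
  by move=> q [Vq _]; exact (VU q Vq).
move=> q [/e[qb {}e] /e'[qd {}e']]; exists (notin_mul qb qd) => Uq.
by rewrite e e' mulr_frac.
Qed.

Definition ss_mul s t : specSect U := SpecSect (@ss_mul_frac s t).

Lemma ss_addA : associative ss_add.
Proof. by move=> s t r; apply: specSectP => p Up /=; rewrite addrA. Qed.

Lemma ss_addC : commutative ss_add.
Proof. by move=> s t; apply: specSectP => p Up /=; rewrite addrC. Qed.

Lemma ss_add0 : left_id ss_zero ss_add.
Proof. by move=> s; apply: specSectP => p Up; exact: add0r. Qed.

Lemma ss_addN : left_inverse ss_zero ss_opp ss_add.
Proof. by move=> s; apply: specSectP => p Up; exact: addNr. Qed.

HB.instance Definition _ :=
  GRing.isZmodule.Build (specSect U) ss_addA ss_addC ss_add0 ss_addN.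

Lemma ss_mulA : associative ss_mul.
Proof. by move=> s t r; apply: specSectP => p Up /=; rewrite mulrA. Qed.

Lemma ss_mulC : commutative ss_mul.
Proof. by move=> s t; apply: specSectP => p Up /=; rewrite mulrC. Qed.

Lemma ss_mul1 : left_id ss_one ss_mul.
Proof. by move=> s; apply: specSectP => p Up; exact: mul1r. Qed.

Lemma ss_mulDl : left_distributive ss_mul +%R.
Proof. by move=> s t r; apply: specSectP => p Up; exact: mulrDl. Qed.

HB.instance Definition _ := GRing.Zmodule_isComPzRing.Build (specSect U)
  ss_mulA ss_mulC ss_mul1 ss_mulDl.

End SpecSectRing.

Section SpecRestriction.
Variables (U V : opens (spec A)) (VU : V `<=` U).

Lemma ss_res_frac (s : specSect U) :
  locally_frac (fun p (Vp : V p) => s p (VU Vp)).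
Proof.
move=> p Vp; have [W [a [b [Wp WU e]]]] := ss_frac s (VU Vp).
exists (opensI W V), a, b; split=> //; first by move=> q [].
by move=> q [/e[qb {}e] _]; exists qb => Vq.
Qed.

Definition ss_res (s : specSect U) : specSect V := SpecSect (ss_res_frac s).

Lemma ss_res_is_zmod_morphism : zmod_morphism ss_res.
Proof. by move=> s t; exact: specSectP. Qed.

Lemma ss_res_is_monoid_morphism : monoid_morphism ss_res.
Proof. by split=> [|s t]; exact: specSectP. Qed.

HB.instance Definition _ := GRing.isZmodMorphism.Build
  (specSect U) (specSect V) ss_res ss_res_is_zmod_morphism.
HB.instance Definition _ := GRing.isMonoidMorphism.Build
  (specSect U) (specSect V) ss_res ss_res_is_monoid_morphism.

End SpecRestriction.

Lemma ss_res_id (U : opens (spec A)) (UU : U `<=` U) (s : specSect U) :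
  ss_res UU s = s.
Proof.
apply: specSectP => p Up /=.
by congr (ss_fun s); exact: Prop_irrelevance.
Qed.

Lemma ss_res_comp (U V W : opens (spec A))
    (VU : V `<=` U) (WV : W `<=` V) (WU : W `<=` U) (s : specSect U) :
  ss_res WV (ss_res VU s) = ss_res WU s.
Proof.
apply: specSectP => p Wp /=.
by congr (ss_fun s); exact: Prop_irrelevance.
Qed.

Lemma ss_glue (I : Type) (U : opens (spec A)) (V : I -> opens (spec A))
    (VU : forall i, V i `<=` U) (s : forall i, specSect (V i)) :
  U `<=` \bigcup_i V i ->
  (forall i j, ss_res (@opensIl _ (V i) (V j)) (s i) =
               ss_res (@opensIr _ (V i) (V j)) (s j)) ->
  exists! t : specSect U, forall i, ss_res (VU i) t = s i.
Proof.
move=> cov comp.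
have compE i j p (Vi : V i p) (Vj : V j p) : s i p Vi = s j p Vj.
  have := congr1 (fun t : specSect (opensI (V i) (V j)) => t p (conj Vi Vj)) (comp i j) => /=.
  by rewrite (Prop_irrelevance (opensIl _) Vi) (Prop_irrelevance (opensIr _) Vj).
have covE p (Up : U p) : exists i, V i p.
  by have [i _ Vi] := cov p Up; exists i.
pose t0 p (Up : U p) := s _ p (projT2 (cid (covE p Up))).
have t0E i p (Vi : V i p) (Up : U p) : t0 p Up = s i p Vi by exact: compE.
have t0_frac : locally_frac t0.
  move=> p Up; have [i Vi] := covE p Up.
  have [W [a [b [Wp WV e]]]] := ss_frac (s i) Vi.
  exists W, a, b; split=> //; first exact: subset_trans WV (VU i).
  move=> q Wq; have [qb {}e] := e q Wq; exists qb => Uq.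
  by rewrite (t0E i q (WV q Wq)) e.
exists (SpecSect t0_frac); split.
  by move=> i; apply: specSectP => p Vi; exact: t0E.
move=> t tE; apply: specSectP => p Up /=.
have [i Vi] := covE p Up; rewrite (t0E i p Vi) -tE /=.
by congr (ss_fun t); exact: Prop_irrelevance.
Qed.

Definition Spec_rs : ringedSpace :=
  @RingedSpace (spec A) specSect (fun U V VU => @ss_res U V VU)
    ss_res_id ss_res_comp ss_glue.

End Spec.

(** Isomorphism of ringed spaces onto an open subspace. *)
Definition open_immersion (Y X : ringedSpace) (j : rsHom Y X) : Prop :=
  [/\ injective j,
      forall V : set Y, open V -> open (j @` V) &
      forall U : opens X, U `<=` range j -> bijective (pull j U)].

Definition affine_open (X : ringedSpace) (U : opens X) : Prop :=
  exists (A : comPzRingType) (j : rsHom (Spec_rs A) X),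
    open_immersion j /\ range j = U.

Record locallyRingedSpace := LocallyRingedSpace {
  lrs_rs :> ringedSpace;
  lrs_local : forall x : lrs_rs, is_local (stalk x) }.

Section LocalRingAt.
Variables (X : locallyRingedSpace) (x : X).

Definition nz_stalk : Type := stalk x.
HB.instance Definition _ := GRing.ComPzRing.on nz_stalk.

Lemma nz_stalk_oner_neq0 : (1 : nz_stalk) != 0.
Proof. by apply/eqP; exact: (lrs_local x).1. Qed.

HB.instance Definition _ :=
  GRing.PzSemiRing_isNonZero.Build nz_stalk nz_stalk_oner_neq0.

Definition local_ring_at : localRing := @LocalRing nz_stalk (lrs_local x).

End LocalRingAt.

Definition residue_field_at (X : locallyRingedSpace) (x : X) : fieldType :=
  residue_field (local_ring_at x).

Record lrsHom (Y X : locallyRingedSpace) := LrsHom {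
  lrs_hom :> rsHom Y X;
  lrs_hom_local : forall (y : Y) (a : stalk (lrs_hom y)),
    invertible (stalk_map lrs_hom a) -> invertible a }.

Section ResidueMap.
Variables (Y X : locallyRingedSpace) (f : lrsHom Y X) (y : Y).

Definition residue_map (k : residue_field_at (f y)) : residue_field_at y :=
  @residue (local_ring_at y) (stalk_map f (repr k)).

Lemma residue_mapE (a : local_ring_at (f y)) :
  residue_map (residue a) = @residue (local_ring_at y) (stalk_map f a).
Proof.
apply/residue_eq => inv.
have : residue (repr (residue a)) = residue a by rewrite /residue reprK.
move=> /residue_eq; apply.
apply: (@lrs_hom_local _ _ f); rewrite [X in invertible X]rmorphB.
exact: inv.
Qed.

Lemma residue_map_is_zmod_morphism : zmod_morphism residue_map.
Proof.
move=> k l; have [a ->] := residue_surj k; have [b ->] := residue_surj l.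
rewrite -rmorphB !residue_mapE -rmorphB; congr residue; exact: rmorphB.
Qed.

Lemma residue_map_is_monoid_morphism : monoid_morphism residue_map.
Proof.
split=> [|k l].
  rewrite -(rmorph1 (@residue _)) residue_mapE.
  rewrite -[RHS](rmorph1 (@residue _)); congr residue; exact: rmorph1.
have [a ->] := residue_surj k; have [b ->] := residue_surj l.
rewrite -rmorphM !residue_mapE -rmorphM; congr residue; exact: rmorphM.
Qed.

HB.instance Definition _ := GRing.isZmodMorphism.Build
  (residue_field_at (f y)) (residue_field_at y) residue_map
  residue_map_is_zmod_morphism.
HB.instance Definition _ := GRing.isMonoidMorphism.Build
  (residue_field_at (f y)) (residue_field_at y) residue_map
  residue_map_is_monoid_morphism.

End ResidueMap.

Arguments residue_map {Y X} f y k.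

(** An isomorphism of ringed spaces between locally ringed spaces is
    automatically local, so [affine_open] need not ask for it. *)
Record scheme := Scheme {
  scheme_lrs :> locallyRingedSpace;
  scheme_affine : forall x : scheme_lrs,
    exists2 U : opens scheme_lrs, affine_open U & U x }.

Definition everywhere_strictly_local (X : scheme) : Prop :=
  forall x : X, strictly_local (local_ring_at x).

Definition irreducible_space (T : topologicalType) : Prop :=
  [set: T] !=set0 /\
  forall F G : set T, closed F -> closed G -> F `|` G = setT ->
    F = setT \/ G = setT.

(** In particular, integral morphisms are affine. *)
Definition integral_morphism (Y X : scheme) (f : lrsHom Y X) : Prop :=
  forall V : opens X, affine_open V ->
    affine_open (preimage_opens f V) /\ integral_hom (pull f V).

Definition radical_morphism (Y X : scheme) (f : lrsHom Y X) : Prop :=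
  injective f /\
  forall y : Y, purely_inseparable_hom (residue_map f y).

(* Main.v *)
From HB Require Import structures.
Require Import Defs.
From mathcomp Require Import all_boot all_order all_algebra all_field.
From mathcomp Require Import ring.
From mathcomp Require Import mathcomp_extra boolp classical_sets topology.

(** Let [f : Y -> X] be integral, [x] a point of [X], [V] an affine open
    neighbourhood of [x], so that the preimage of [V] is a [Spec B] all of whose
    sections are integral over the sections of [V].

    Injectivity. If two points [y <> y'] of [Y] lie over [x], some [b] in [B]
    vanishes at one of them, say [y], and not at the other, [y']. Let [P] be a
    monic polynomial over the local ring at [x] with [P(b) = 0]. Its reduction
    is [h0 * 'X^k] with [h0(0) <> 0], and Hensel's lemma lifts this to
    [P = g * h] ([no_separating_section]). At [y], where [b] vanishes, [h(b)] is
    a unit, hence [g(b) = 0] in the stalk at [y], that is, near [y]. At [y'],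
    where [b] is a unit, [g(b)] reduces to the [k]-th power of [b] and is a unit,
    hence it is one near [y']. In an irreducible space these two neighbourhoods
    meet ([irreducible_germ0]), at a point where [0] would be a unit. The argument
    takes place in stalks and small open sets only, so that the global sections
    of a spectrum need not be computed: it is enough that elements of [B] define
    sections whose vanishing at a point is membership in the corresponding prime
    ([represents_invertible]).

    Residue fields. Every element of the residue field at a point of [Spec B] is
    a quotient of values of elements of [B] ([germ_fraction]), so it is algebraic
    over the residue field at [x]. That field is separably closed, and an
    algebraic extension of a separably closed field is purely inseparable
    ([separably_closed_algebraic_purely_inseparable]). *)

Set Implicit Arguments.
Unset Strict Implicit.
Unset Printing Implicit Defensive.

Import GRing.Theory.
Local Open Scope classical_set_scope.
Local Open Scope ring_scope.

(** * Algebraic extensions of separably closed fields *)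

(** A zero derivative kills every coefficient whose index is prime to the
    characteristic; applied to the leading coefficient, it shows that the
    characteristic is positive. *)
Lemma deriv0_comp_poly_Xn (K : fieldType) (p : {poly K}) :
  p^`() = 0 -> (1 < size p)%N ->
  exists2 c, c \in [pchar K] & exists q : {poly K}, p = q \Po 'X^c.
Proof.
move=> p'0 p_gt1.
have coef0 i : p`_i *+ i = 0.
  by case: i => [|i]; rewrite ?mulr0n // -coef_deriv p'0 coef0.
have lead0 : ((size p).-1)%:R == 0 :> K.
  have /eqP := coef0 (size p).-1.
  rewrite -[X in X == _]mulr_natr mulf_eq0 -lead_coefE lead_coef_eq0.
  case/orP=> //.
  by rewrite -size_poly_eq0; case: size p_gt1.
have pred_gt0 : (0 < (size p).-1)%N by rewrite -subn1 subn_gt0.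
have [c char_c] := natf0_pchar pred_gt0 lead0.
exists c => //; exists (\poly_(i < size p) p`_(i * c)).
have c_gt0 := prime_gt0 (pcharf_prime char_c).
apply/polyP => i; rewrite coef_comp_poly_Xn // coef_poly.
case: ifPn => [/dvdnP[k ->]|ci]; last first.
  apply/eqP; have /eqP := coef0 i; rewrite -[X in X == _]mulr_natr mulf_eq0.
  by rewrite -(dvdn_pcharf char_c) (negPf ci) orbF.
rewrite mulnK //; case: ltnP => // pk; apply: nth_default.
by apply: leq_trans pk _; rewrite leq_pmulr.
Qed.

(** Among the polynomials [p != 0] over [K] that vanish at a power [x ^+ n] of
    [x], [n] a power of the characteristic exponent, take one of minimal degree.
    It has no proper factor, and it is not a polynomial in a power ['X^c], [c]
    the characteristic, since then [n * c] would allow a smaller degree. So it is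
    separable, has a root in [K], and is linear. *)
Lemma separably_closed_algebraic_purely_inseparable (K L : fieldType)
    (f : {rmorphism K -> L}) :
  separably_closed K -> (forall x : L, algebraicOver f x) ->
  purely_inseparable_hom f.
Proof.
move=> sepK algL x.
pose P m := `[< exists n (p : {poly K}), [/\ [pchar L].-nat n, p != 0,
  size p = m & root (map_poly f p) (x ^+ n)] >].
have exP : exists m, P m.
  have [p p0 px] := algL x; exists (size p); apply/asboolP.
  by exists 1%N, p; split; rewrite ?expr1.
have [_ /asboolP[n [p [nP p0 <- px]]] minp] := ex_minnP exP.
have pmin m q : [pchar L].-nat m -> q != 0 -> root (map_poly f q) (x ^+ m) ->
    (size p <= size q)%N.
  by move=> mP q0 qx; apply: minp; apply/asboolP; exists m, q.
have pn0 := root_size_gt1 _ px; rewrite map_poly_eq0 size_map_poly in pn0.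
have {pn0} p_gt1 := pn0 p0.
(* A factor of smaller degree does not vanish at [x ^+ n], so its cofactor
   does. *)
have fac q r : p = q * r -> (size q < size p)%N -> size r = size p.
  move=> pqr qp; have [q0 r0] : q != 0 /\ r != 0.
    by apply/andP; rewrite -negb_or -mulf_eq0 -pqr.
  apply/eqP; rewrite eqn_leq; apply/andP; split.
    by apply: dvdp_leq => //; rewrite pqr dvdp_mull.
  move: px; rewrite pqr rmorphM rootM -pqr => /orP[qx|]; last exact: pmin.
  by have := pmin _ _ nP q0 qx; rewrite leqNgt qp.
exists n => //.
have [p'0|p'0] := eqVneq p^`() 0.
  have [c char_c [q pq]] := deriv0_comp_poly_Xn p'0 p_gt1.
  have c_gt1 := prime_gt1 (pcharf_prime char_c).
  have q0 : q != 0 by apply: contraNneq p0 => q0; rewrite pq q0 comp_poly0.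
  have ncP : [pchar L].-nat (n * c).
    by rewrite pnatM nP pnatE ?(pcharf_prime char_c) // (fmorph_pchar f).
  have qx : root (map_poly f q) (x ^+ (n * c)).
    move: px; rewrite pq map_comp_poly map_polyXn /root horner_comp hornerXn.
    by rewrite exprM.
  have sizeE : (size p).-1 = ((size q).-1 * c)%N.
    by rewrite pq size_comp_poly size_polyXn.
  have : ((size p).-1 <= (size q).-1)%N.
    by rewrite -!subn1 leq_sub2r //; exact: pmin ncP q0 qx.
  have : (0 < (size p).-1)%N by rewrite -subn1 subn_gt0.
  rewrite sizeE muln_gt0 => /andP[q_gt0 _].
  by rewrite -[X in (_ <= X)%N]muln1 leq_pmul2l // leqNgt c_gt1.
(* A gcd [d] of [p] and its derivative is a factor of smaller degree, hence
   constant. *)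
have sep_p : separable_poly p.
  rewrite separable_poly.unlock coprimep_def; set d := gcdp _ _.
  have /dvdpP[e pe] : d %| p by exact: dvdp_gcdl.
  have dp : (size d < size p)%N.
    apply: leq_ltn_trans (lt_size_deriv p0).
    by apply: dvdp_leq => //; exact: dvdp_gcdr.
  have e_p := fac d e; rewrite mulrC in e_p; have {}e_p := e_p pe dp.
  have [d0 e0] : d != 0 /\ e != 0.
    by apply/andP; rewrite -negb_or -mulf_eq0 mulrC -pe.
  have := size_mul e0 d0; rewrite -pe e_p.
  have := size_poly_eq0 d; rewrite (negPf d0); case: (size d) => [|[|k]] //= _.
  rewrite addnS /= addnS => /eqP.
  by rewrite -addnS -[X in X == _]addn0 eqn_add2l.
have [a /factor_theorem[q pq]] := sepK _ sep_p p_gt1.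
move: px; rewrite pq rmorphM rmorphB /= map_polyX map_polyC rootM root_XsubC.
case/orP => [qx|/eqP ->]; last by exists a.
have q0 : q != 0 by apply: contraNneq p0 => q0; rewrite pq q0 mul0r.
have := pmin _ _ nP q0 qx.
by rewrite pq size_Mmonic ?monicXsubC // size_XsubC addn2 ltnn.
Qed.

(** * Germs and irreducible spaces *)

Lemma invertible_rmorph (R S : comPzRingType) (f : {rmorphism R -> S}) (a : R) :
  invertible a -> invertible (f a).
Proof. by case=> b ab; exists (f b); rewrite -rmorphM ab rmorph1. Qed.

Section Germs.
Variable X : ringedSpace.

Lemma germ_inj_nbhd (U : opens X) (x : X) (Ux : U x) (s t : sect X U) :
  germ Ux s = germ Ux t ->
  exists (W : opens X) (WU : W `<=` U), W x /\ res WU s = res WU t.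
Proof.
move=> /germ_eq[W [WU [WU' [Wx e]]]]; exists W, WU; split=> //.
by rewrite e (Prop_irrelevance WU' WU).
Qed.

Lemma germ_invertible_nbhd (U : opens X) (x : X) (Ux : U x) (s : sect X U) :
  invertible (germ Ux s) ->
  exists (W : opens X) (WU : W `<=` U), W x /\ invertible (res WU s).
Proof.
move=> [b]; have [V [Vx [t ->]]] := germ_surj b.
pose UV := opensI U V.
have Ix : UV x by split.
rewrite -(germ_res (@opensIl _ U V) Ux Ix) -(germ_res (@opensIr _ U V) Vx Ix).
rewrite -rmorphM -(rmorph1 (germ Ix)) => /germ_inj_nbhd[W [WI [Wx e]]].
exists W, (subset_trans WI (@opensIl _ U V)); split=> //.
exists (res WI (res (@opensIr _ U V) t)).
rewrite -(res_comp (@opensIl _ U V) WI).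
by rewrite -rmorphM e rmorph1.
Qed.

Lemma germ_family (x : X) (n : nat) (a : nat -> stalk x) :
  exists (U : opens X) (Ux : U x) (s : nat -> sect X U),
    forall i, (i < n)%N -> germ Ux (s i) = a i.
Proof.
elim: n => [|n [U [Ux [s sa]]]].
  by exists (opensT X), I, (fun=> 0).
have [V [Vx [t ta]]] := germ_surj (a n).
have Ix : opensI U V x by split.
exists (opensI U V), Ix, (fun i => if (i < n)%N then res (@opensIl _ U V) (s i)
  else res (@opensIr _ U V) t) => i; rewrite ltnS leq_eqVlt.
case: ltnP => [i_n _|]; first by rewrite (germ_res _ Ux) sa.
by move=> _; rewrite orbF => /eqP ->; rewrite (germ_res _ Vx).
Qed.

End Germs.

Lemma irreducible_opens_meet (T : topologicalType) (U V : opens T) :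
  irreducible_space T -> U !=set0 -> V !=set0 -> exists z, U z /\ V z.
Proof.
move=> [_ irrT] [u Uu] [v Vv]; apply: contrapT => disj.
have clC (W : opens T) : closed (~` W) by exact/open_closedC/opensP.
have UVT : ~` U `|` ~` V = setT.
  rewrite -setCI; apply/seteqP; split=> // z _ [Uz Vz].
  by apply: disj; exists z.
have [/seteqP[_ /(_ u I)]|/seteqP[_ /(_ v I)]] := irrT _ _ (clC U) (clC V) UVT.
- exact.
- exact.
Qed.

(** A section that is zero near [y] and a unit near [y'] would be both at a
    common point of the two neighbourhoods, whose stalk is not the zero ring. *)
Lemma irreducible_germ0 (Y : locallyRingedSpace) (U : opens Y) (y y' : Y)
    (Uy : U y) (Uy' : U y') (s : sect Y U) :
  irreducible_space Y -> germ Uy s = 0 -> ~ invertible (germ Uy' s).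
Proof.
move=> irrY; rewrite -(rmorph0 (germ Uy)) => /germ_inj_nbhd[W [WU [Wy s0]]].
move=> /germ_invertible_nbhd[V [VU [Vy' sV]]].
have [||z [Wz Vz]] := irreducible_opens_meet (U := W) (V := V) irrY.
- by exists y.
- by exists y'.
have [b] := invertible_rmorph (germ Vz) sV => /=.
rewrite (germ_res VU (WU z Wz)) -(germ_res WU _ Wz) s0 !rmorph0 mul0r.
by move/esym; case: (lrs_local z).
Qed.

(** * Polynomials over stalks *)

Lemma residue0P (R : localRing) (a : R) : residue a = 0 <-> ~ invertible a.
Proof. by rewrite -(rmorph0 (@residue R)) residue_eq subr0. Qed.

Section NzMorphisms.
Variables (Y X : locallyRingedSpace).

(** [germ] and [stalk_map] with values in the stalk seen as a nonzero ring, over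
    which polynomials can be formed. *)
Definition nz_germ (x : X) (U : opens X) (Ux : U x) (s : sect X U) :
  local_ring_at x := germ Ux s.

HB.instance Definition _ (x : X) (U : opens X) (Ux : U x) :=
  GRing.isZmodMorphism.Build (sect X U) (local_ring_at x) (nz_germ Ux)
    (@germ_is_zmod_morphism X x U Ux).
HB.instance Definition _ (x : X) (U : opens X) (Ux : U x) :=
  GRing.isMonoidMorphism.Build (sect X U) (local_ring_at x) (nz_germ Ux)
    (@germ_is_monoid_morphism X x U Ux).

Variable f : lrsHom Y X.

Definition nz_stalk_map (y : Y) (a : local_ring_at (f y)) : local_ring_at y :=
  stalk_map f a.

HB.instance Definition _ (y : Y) :=
  GRing.isZmodMorphism.Build (local_ring_at (f y)) (local_ring_at y)
    (@nz_stalk_map y) (@stalk_map_is_zmod_morphism Y X f y).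
HB.instance Definition _ (y : Y) :=
  GRing.isMonoidMorphism.Build (local_ring_at (f y)) (local_ring_at y)
    (@nz_stalk_map y) (@stalk_map_is_monoid_morphism Y X f y).

(** With [residue0P], this reads off whether [p(b)] is a unit at [y] from the
    reductions of [p] and [b]. *)
Lemma residue_horner (y : Y) (p : {poly local_ring_at (f y)})
    (b : local_ring_at y) :
  residue (map_poly (@nz_stalk_map y) p).[b] =
  (map_poly (residue_map f y) (map_poly (@residue _) p)).[residue b].
Proof.
rewrite -horner_map -!map_poly_comp; congr (_.[_]).
apply: eq_map_poly => a /=; symmetry; exact: residue_mapE.
Qed.

End NzMorphisms.

Definition germ_poly (X : locallyRingedSpace) (x : X) (U : opens X) (Ux : U x)
    (n : nat) (s : nat -> sect X U) : {poly local_ring_at x} :=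
  \poly_(i < n) nz_germ Ux (s i).

(** The finitely many coefficients are germs on one neighbourhood, so a
    polynomial over the stalk at [x] also makes sense at the points near [x]. *)
Lemma germ_polyP (X : locallyRingedSpace) (x : X)
    (p : {poly local_ring_at x}) :
  exists (U : opens X) (Ux : U x) (n : nat) (s : nat -> sect X U),
    p = germ_poly Ux n s.
Proof.
have [U [Ux [s sp]]] := germ_family (size p) (fun i => p`_i : stalk x).
exists U, Ux, (size p), s; apply/polyP => i; rewrite coef_poly.
by case: ltnP => [/sp/esym//|/(nth_default 0)].
Qed.

(** The two stalks are different types, although [x = x']; a polynomial with
    explicit sections as coefficients makes sense over both. *)
Lemma germ_poly_transport (X : locallyRingedSpace) (x x' : X) (U : opens X)
    (Ux : U x) (Ux' : U x') (n k : nat) (s : nat -> sect X U) :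
  x = x' ->
  map_poly (@residue _) (germ_poly Ux n s) = 'X^k ->
  map_poly (@residue _) (germ_poly Ux' n s) = 'X^k.
Proof. by move=> e; subst x'; rewrite (Prop_irrelevance Ux Ux'). Qed.

Definition integral_elt (A B : comPzRingType) (f : A -> B) (b : B) : Prop :=
  exists (n : nat) (c : 'I_n -> A), b ^+ n + \sum_(i < n) f (c i) * b ^+ i = 0.

(** Integrality equations are given with coefficients in rings of sections,
    which may be zero rings; their polynomial is formed over a nonzero ring. *)
Lemma monic_lift (R : nzRingType) (n : nat) (c : 'I_n -> R) :
  exists2 p : {poly R}, p \is monic &
    forall (S : nzRingType) (f : {rmorphism R -> S}) (b : S),
      (map_poly f p).[b] = b ^+ n + \sum_(i < n) f (c i) * b ^+ i.
Proof.
pose q := \sum_(i < n) c i *: 'X^i.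
exists ('X^n + q) => [|S f b].
  have q_n : (size q <= n)%N.
    apply: (leq_trans (size_sum _ _ _)); apply/bigmax_leqP => i _.
    apply: (leq_trans (size_scale_leq _ _)); rewrite size_polyXn.
    exact: ltn_ord.
  by rewrite monicE lead_coefDl ?size_polyXn ?ltnS // lead_coefXn.
rewrite rmorphD /= map_polyXn hornerD hornerXn; congr (_ + _).
rewrite rmorph_sum horner_sum; apply: eq_bigr => i _.
by rewrite /= map_polyZ map_polyXn hornerZ hornerXn.
Qed.

(** * Integral sections do not separate points of a fibre *)

Section Fibre.
Variables (Y X : locallyRingedSpace) (f : lrsHom Y X).
Variables (V : opens X) (b : sect Y (preimage_opens f V)).

Lemma integral_germ (y : Y) (Vy : V (f y)) :
  integral_elt (pull f V) b ->
  integralOver (@nz_stalk_map _ _ f y) (nz_germ (Vy : preimage_opens f V y) b).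
Proof.
move=> [n [c bc]].
have [p monp pE] := monic_lift (fun i => nz_germ Vy (c i)).
exists p => //; rewrite /root pE.
have := congr1 (nz_germ (Vy : preimage_opens f V y)) bc.
rewrite rmorphD rmorphXn rmorph_sum rmorph0 => /= e.
apply/eqP; rewrite -[RHS]e; congr (_ + _); apply: eq_bigr => i _.
rewrite rmorphM rmorphXn /=; congr (_ * _).
exact: stalk_map_germ.
Qed.

(** Hensel's lemma splits the integrality equation of [b] into [g(b) * h(b) = 0],
    [g] reducing to ['X^k] and [h] to a polynomial with nonzero constant term. If
    [b] is not a unit at [y] then [h(b)] is one there, so [g(b) = 0]; if [b] is a
    unit at [y'] then so is [g(b)]. The irreducibility of [Y] excludes this. *)
Lemma no_separating_section (y y' : Y) (Vy : V (f y)) (Vy' : V (f y')) :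
  irreducible_space Y -> henselian (local_ring_at (f y)) ->
  integral_elt (pull f V) b -> f y = f y' ->
  ~ invertible (germ (Vy : preimage_opens f V y) b) ->
  ~ invertible (germ (Vy' : preimage_opens f V y') b).
Proof.
move=> irrY hens int_b e b_y b_y'.
have [P monP /rootP P_b] := integral_germ Vy int_b.
have /residue0P b_y0 :
  ~ invertible (nz_germ (Vy : preimage_opens f V y) b) := b_y.
pose P0 := map_poly (@residue _) P.
have monP0 : P0 \is monic by exact: monic_map.
have [k [h0 h00 P0E]] := multiplicity_XsubC P0 0.
rewrite monic_neq0 //= in h00.
have monXk : ('X - 0%:P) ^+ k \is @monic (residue_field_at (f y)).
  by rewrite monic_exp ?monicXsubC.
have monh0 : h0 \is monic by rewrite -(monicMr _ monXk) -P0E.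
have cop : coprimep (('X - 0%:P) ^+ k) h0.
  by rewrite coprimep_expl // coprimep_sym coprimep_XsubC.
rewrite mulrC in P0E.
have [g [h [mong monh PE gE hE]]] := hens _ _ _ monP monXk monh0 cop P0E.
rewrite subr0 in gE.
set beta := nz_germ (Vy : preimage_opens f V y) b in P_b b_y0.
have h_unit : invertible (map_poly (@nz_stalk_map _ _ f y) h).[beta].
  apply: contrapT => /residue0P; rewrite residue_horner hE b_y0 => /eqP.
  rewrite -[X in _.[X]](rmorph0 (residue_map f y)) horner_map fmorph_eq0.
  exact/negP.
have g_0 : (map_poly (@nz_stalk_map _ _ f y) g).[beta] = 0.
  have [u hu] := h_unit; rewrite -[LHS]mulr1 -hu mulrA -hornerM -rmorphM -PE.
  by rewrite P_b mul0r.
have [U [Uy [n [s gs]]]] := germ_polyP g.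
have Uy' : U (f y') by rewrite -e.
(* The section [G] is [g(b)], spread out over an open set with both points. *)
pose VU := opensI (preimage_opens f V) (preimage_opens f U).
have Iy : VU y by split.
have Iy' : VU y' by split.
pose G : sect Y VU := \sum_(i < n)
  res (@opensIr _ _ _) (pull f U (s i)) * res (@opensIl _ _ _) b ^+ i.
have GE (z : Y) (Vz : V (f z)) (Uz : U (f z)) (Iz : VU z) :
    nz_germ Iz G = (map_poly (@nz_stalk_map _ _ f z) (germ_poly Uz n s)).[
      nz_germ (Vz : preimage_opens f V z) b].
  rewrite /germ_poly poly_def [map_poly _ _]rmorph_sum horner_sum.
  rewrite /G rmorph_sum.
  apply: eq_bigr => i _.
  rewrite /= map_polyZ map_polyXn hornerZ hornerXn rmorphM rmorphXn /=.
  congr (_ * _ ^+ _); last exact: germ_res.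
  transitivity (nz_germ (Uz : preimage_opens f U z) (pull f U (s i))).
    exact: germ_res.
  by symmetry; exact: stalk_map_germ.
apply: (@irreducible_germ0 Y VU y y' Iy Iy' G irrY).
  by have := GE y Vy Uy Iy; rewrite -gs g_0.
rewrite -[germ _ _]/(nz_germ Iy' G) (GE y' Vy' Uy').
apply: contrapT => /(residue0P (_ : local_ring_at y')).
rewrite residue_horner (germ_poly_transport Uy' e _ (k := k)) -?gs //.
rewrite map_polyXn hornerXn => /eqP; rewrite expf_eq0 => /andP[_ /eqP].
by move/residue0P; apply.
Qed.

End Fibre.

(** * Elements of a ring as sections over an open subspace isomorphic to its
    spectrum *)

Lemma spec_ext (B : comPzRingType) (p q : spec B) :
  (forall b, p b -> q b) -> (forall b, q b -> p b) -> p = q.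
Proof.
case: p q => [p p0 pD pM p1 pP] [q q0 qD qM q1 qP] /= pq qp.
have e : p = q by apply/seteqP.
by subst q; f_equal; exact: Prop_irrelevance.
Qed.

Section OpenImmersion.
Variables (Y : ringedSpace) (B : comPzRingType) (j : rsHom (Spec_rs B) Y).
Hypothesis jP : open_immersion j.

Definition spec_const (U : opens (spec B)) (b : B) : specSect U :=
  SpecSect (@ss_const_frac B U b).

Definition represents (U : opens Y) (s : sect Y U) (b : B) : Prop :=
  pull j U s = spec_const (preimage_opens j U) b.

Lemma represented (U : opens Y) (b : B) :
  U `<=` range j -> exists s : sect Y U, represents s b.
Proof.
move=> Uj; have [_ _ /(_ U Uj)[g _ gK]] := jP.
by exists (g (spec_const _ b)); exact: gK.
Qed.

Lemma pull_res_at (U W : opens Y) (WU : W `<=` U) (s : sect Y U) (q : spec B)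
    (Wq : preimage_opens j W q) :
  (pull j W (res WU s) : specSect _) q Wq =
  (pull j U s : specSect _) q (WU (j q) Wq).
Proof.
have jWU : preimage_opens j W `<=` preimage_opens j U.
  by move=> z; exact (WU (j z)).
rewrite (pull_res WU jWU) /=.
by rewrite (Prop_irrelevance (jWU _ _) (WU (j q) Wq)).
Qed.

Lemma sect_ext (U : opens Y) (s t : sect Y U) :
  U `<=` range j ->
  (forall (q : spec B) (Uq : preimage_opens j U q),
    (pull j U s : specSect _) q Uq = (pull j U t : specSect _) q Uq) ->
  s = t.
Proof.
move=> Uj st; have [_ _ /(_ U Uj)/bij_inj] := jP; apply.
exact: specSectP.
Qed.

Definition image_opens (V : opens (spec B)) : opens Y :=
  Opens ((let: And3 _ h _ := jP in h) V (opensP V)).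

Lemma image_opensE (V : opens (spec B)) (q : spec B) :
  preimage_opens j (image_opens V) q -> V q.
Proof. by case: jP => jinj _ _ [p Vp /jinj <-]. Qed.

(** If [b] is in the prime [q], so is every multiple of it, and [b] cannot be a
    unit of the localization. Otherwise [1 / b] is a section on the image of the
    basic open set of [b]. *)
Lemma represents_invertible (U : opens Y) (s : sect Y U) (b : B) (q : spec B)
    (Uq : U (j q)) :
  U `<=` range j -> represents s b -> invertible (germ Uq s) <-> ~ q b.
Proof.
move=> Uj sb.
have sbq (p : spec B) (Up : preimage_opens j U p) :
  (pull j U s : specSect _) p Up = Defs.frac b (@spec1 _ p) by rewrite sb.
split=> [/germ_invertible_nbhd[W [WU [Wq [t st]]]] qb | qb].
  have := congr1 (fun r => (pull j W r : specSect _) q Wq) st.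
  rewrite rmorphM rmorph1 /= (pull_res_at WU s Wq) sbq.
  have [c [d [qd ->]]] := frac_surj ((pull j W t : specSect _) q Wq).
  rewrite mulr_frac => /frac_eq[u qu e].
  apply: (notin_mul qu qd).
  have <- : u * (b * c) = u * d.
    apply/eqP; rewrite -subr_eq0 -mulrBr; apply/eqP; rewrite -{}e.
    by congr (_ * _); ring.
  by apply: specM; rewrite mulrC; exact: specM.
pose D : opens (spec B) :=
  @Opens (spec B) [set p : spec B | exists2 a, [set b] a & ~ p a]
    (ex_intro _ [set b] erefl).
pose W := opensI (image_opens D) U.
have Dq : D q by exists b.
have Wq : W (j q) by split; [exists q|].
have Wj : W `<=` range j by apply: subset_trans Uj; exact: opensIr.
have Db (p : spec B) (Wp : preimage_opens j W p) : ~ p b.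
  by have [a -> ] := image_opensE Wp.1.
have t_frac : locally_frac
    (fun p (Wp : preimage_opens j W p) => Defs.frac 1 (Db p Wp)).
  move=> p Wp; exists (preimage_opens j W), 1, b; split=> [//|//|p' Wp'].
  by exists (Db p' Wp') => Wp''; congr Defs.frac; exact: Prop_irrelevance.
have [g _ gK] : bijective (pull j W) by case: jP => _ _; apply.
pose t := g (SpecSect t_frac).
exists (germ Wq t); rewrite -(germ_res (@opensIr _ _ _) Uq Wq) -rmorphM.
rewrite -(rmorph1 (germ Wq)); congr (germ _ _).
apply: sect_ext => // p Wp.
rewrite rmorphM rmorph1 /= pull_res_at sbq gK /= mulr_frac.
by apply: frac_cross; ring.
Qed.

(** A section of the structure sheaf is a fraction [b / t] near [q], so in the
    stalk it is a quotient of two germs of elements of [B]. The quotient is stated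
    without division, and for any open set [U] and any sections [s] and [r] over
    it, since an element of [B] only determines a section once [U] is given. *)
Lemma germ_fraction (q : spec B) (a : stalk (j q)) :
  exists (b t : B), ~ q t /\
    forall (U : opens Y) (Uq : U (j q)) (s r : sect Y U),
      U `<=` range j -> represents s b -> represents r t ->
      a * germ Uq r = germ Uq s.
Proof.
have [S [Sq [a0 ->]]] := germ_surj a.
have [V [b [t [Vq VS aE]]]] := ss_frac (pull j S a0 : specSect _) Sq.
exists b, t; split; first by have [] := aE q Vq.
move=> U Uq s r Uj sb rt.
pose W := opensI (image_opens V) (opensI S U).
have Wq : W (j q) by split; [exists q|].
have WS : W `<=` S by move=> z [_ []].
have WU : W `<=` U by move=> z [_ []].
rewrite -(germ_res WS Sq Wq) -!(germ_res WU Uq Wq) -rmorphM.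
congr (germ _ _); apply: sect_ext => [|p Wp].
  exact: subset_trans WU Uj.
rewrite rmorphM /= !pull_res_at.
have [tp ->] := aE p (image_opensE Wp.1).
rewrite sb rt /= mulr_frac; apply: frac_cross; ring.
Qed.

End OpenImmersion.

(** * Fibres and residue fields over an affine open subset *)

Lemma integral_residue (Y X : locallyRingedSpace) (f : lrsHom Y X) (y : Y)
    (b : local_ring_at y) :
  integralOver (@nz_stalk_map _ _ f y) b ->
  algebraicOver (residue_map f y) (residue b).
Proof.
move=> [p monp /rootP pb]; apply/integral_algebraic.
exists (map_poly (@residue _) p); first exact: monic_map.
by apply/rootP; rewrite -residue_horner pb rmorph0.
Qed.

Section AffinePreimage.
Variables (Y X : locallyRingedSpace) (f : lrsHom Y X) (V : opens X).
Hypothesis V_affine : affine_open (preimage_opens f V).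
Hypothesis V_integral : integral_hom (pull f V).

Lemma fibre_subsingleton (y y' : Y) :
  irreducible_space Y -> henselian (local_ring_at (f y)) ->
  V (f y) -> f y = f y' -> y = y'.
Proof.
move=> irrY hens Vy e; have [B [j [jP jV]]] := V_affine.
have Vy' : V (f y') by rewrite -e.
have jVs : preimage_opens f V `<=` range j by rewrite jV.
have [q _ qy] : range j y by exact: jVs.
have [q' _ qy'] : range j y' by exact: jVs.
(* Stated for both orders of the two points; the prime inclusions are used in
   both directions. *)
have sep : forall z z', V (f z) -> V (f z') -> f z = f z' ->
    henselian (local_ring_at (f z)) ->
    forall p p', j p = z -> j p' = z' -> forall b, p b -> p' b.
  move=> z z' Vz Vz' ez hz p p' pz pz'; subst z z' => b pb.
  have [s sb] := represented jP b jVs; apply: contrapT => p'b.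
  have int_s : integral_elt (pull f V) s by exact: V_integral.
  apply: (no_separating_section (Vy := Vz) (Vy' := Vz') irrY hz int_s ez).
    by move=> /(represents_invertible jP _ jVs sb); apply.
  exact/(represents_invertible jP _ jVs sb).
rewrite -qy -qy'; congr (rs_map j _); apply: spec_ext.
  exact: (sep y y').
by apply: (sep y' y) => //; rewrite -e.
Qed.

(** An element of the residue field is a quotient of values of elements of the
    coordinate ring, each of which is integral. *)
Lemma residue_algebraic (y : Y) (k : residue_field_at y) :
  V (f y) -> algebraicOver (residue_map f y) k.
Proof.
move=> Vy; have [B [j [jP jV]]] := V_affine.
have jVs : preimage_opens f V `<=` range j by rewrite jV.
have [q _ qy] : range j y by exact: jVs.
subst y; have [a ->] := residue_surj k.
have [b [t [qt abt]]] := germ_fraction jP (a : stalk _).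
have [s sb] := represented jP b jVs; have [r rt] := represented jP t jVs.
have Vq : preimage_opens f V (j q) := Vy.
have r_unit : residue (nz_germ Vq r) != 0.
  apply/eqP => /residue0P; apply.
  exact/(represents_invertible jP _ jVs rt).
have -> : residue a = residue (nz_germ Vq s) / residue (nz_germ Vq r).
  apply: (mulIf r_unit); rewrite divfK // -rmorphM; congr residue.
  exact: (abt _ Vq s r jVs sb rt).
apply: algebraic_div; apply: integral_residue;
  by apply: integral_germ (V_integral _).
Qed.

End AffinePreimage.

Theorem lemma2p3 (X Y : scheme) (hX : everywhere_strictly_local X)
    (hY : irreducible_space Y) (f : lrsHom Y X) (hf : integral_morphism f) :
  radical_morphism f /\ injective f.
Proof.
suff f_rad : radical_morphism f by split=> //; exact: f_rad.1.
split=> [y y' e|y].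
  have [V V_aff Vy] := scheme_affine (f y); have [aff int_f] := hf V V_aff.
  exact: fibre_subsingleton aff int_f y y' hY (hX (f y)).1 Vy e.
have [V V_aff Vy] := scheme_affine (f y); have [aff int_f] := hf V V_aff.
apply: separably_closed_algebraic_purely_inseparable (hX (f y)).2 _ => k.
exact: residue_algebraic aff int_f y k Vy.
Qed.
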